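(* If $T$ is a complete first-order theory (with infinite models and monster model $\mathcal{U}$) and $B\subseteq U$ is a small set of parameters, then $\mathrm{DR}(T_B)\leq\mathrm{DR}(T)$.
   Context: Conventions. $T$ is a complete first-order theory in a language $L$ with infinite models, and $\mathcal{U}\models T$, with universe $U$, is a monster model: universal and strongly $\hat\kappa$-homogeneous for a sufficiently large cardinal $\hat\kappa$. ''Small'' means of cardinality $<\hat\kappa$. Variables and parameters may be tuples (finite or infinite, small); all sequences of parameters are small. For a small $B\subseteq U$, $T_B$ is the complete theory of $\mathcal{U}$ expanded by constants naming the elements of $B$. EM-types. A sequence $\mathcal{I}=(b_i:i\in I)$ of tuples of the same size, indexed by an infinite linear order, satisfies $\mathcal I\models^{\mathrm{EM}}\phi(x_0,\dots,x_{n-1})$ if $\mathcal{U}\models\phi(b_{i_0},\dots,b_{i_{n-1}})$ for all $i_0<\cdots<i_{n-1}$ in $I$. The EM-type of $\mathcal I$ (over $\varnothing$) is the set of all $L$-formulas $\phi$ in variables $(x_k:k<\omega)$ with $\mathcal I\models^{\mathrm{EM}}\phi$; $\mathcal I$ is indiscernible iff this EM-type is complete. A complete EM-type is the EM-type of some infinite indiscernible sequence; $S^{\mathrm{EM}}(\kappa\cdot\omega)$ is the set of complete EM-types of sequences of $\kappa$-tuples. Dedekind partitions. A partition $I=I_0+\cdots+I_n$ of a linear order into nonempty convex sets $I_0<\cdots<I_n$ is Dedekind if for each $i<n$ the set $I_0\cup\cdots\cup I_i$ has no maximum and $I_{i+1}\cup\cdots\cup I_n$ has no minimum; the $i$-th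 cut is $\mathfrak c_i=(I_0\cup\cdots\cup I_i,\ I_{i+1}\cup\cdots\cup I_n)$. For an indiscernible sequence $\mathcal I$ indexed by $I$, write $\mathcal I=\mathcal I_0+\cdots+\mathcal I_n$ for the corresponding partition. Given $A=(a_0,\dots,a_{n-1})$ of tuples of the same size as those in $\mathcal I$, a subsequence $A'\subseteq A$ inserts into $\mathcal I_0+\cdots+\mathcal I_n$ if the sequence obtained by inserting each $a_i\in A'$ at the cut $\mathfrak c_i$ is indiscernible. Distality rank. For $n>m>0$, the Dedekind partition $\mathcal I_0+\cdots+\mathcal I_n$ of an indiscernible sequence is $m$-distal if every sequence $A=(a_0,\dots,a_{n-1})$ which does not insert contains an $m$-element subsequence which does not insert. A complete EM-type $\Gamma$ is $m$-distal if every Dedekind partition $\mathcal I_0+\cdots+\mathcal I_{m+1}$ of an indiscernible sequence with EM-type $\Gamma$ is $m$-distal. A theory is $m$-distal if for all of its completions and all tuple sizes $\kappa$, every $\Gamma\in S^{\mathrm{EM}}(\kappa\cdot\omega)$ is $m$-distal. The distality rank $\mathrm{DR}(T)$ is the least $m\ge1$ such that $T$ is $m$-distal, and $\mathrm{DR}(T)=\omega$ if there is no such $m$. *)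

(* Defs.v *)
From mathcomp Require Import all_boot all_order.
From mathcomp Require Import boolp classical_sets functions cardinality.

Set Implicit Arguments.
Unset Strict Implicit.
Unset Printing Implicit Defensive.

Local Open Scope classical_set_scope.
Local Open Scope card_scope.

(** * First-order logic *)

Record language := Language {
  fsym : Type;
  farity : fsym -> nat;
  rsym : Type;
  rarity : rsym -> nat }.

Inductive term (L : language) (V : Type) : Type :=
| Var : V -> term L V
| App : forall f : fsym L, ('I_(farity f) -> term L V) -> term L V.

(** [form L V] is the type of [L]-formulas with free variables in [V]; the
    variable bound by [All] is the extra element [None] of [option V].  The
    omitted connectives are definable, as the metatheory is classical. *)
Inductive form (L : language) (V : Type) : Type :=
| Bot : form L V
| Eq : term L V -> term L V -> form L V
| Rel : forall r : rsym L, ('I_(rarity r) -> term L V) -> form L V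
| Imp : form L V -> form L V -> form L V
| All : form L (option V) -> form L V.

Arguments Bot {L V}.

Definition Neg (L : language) (V : Type) (phi : form L V) : form L V :=
  Imp phi Bot.

Record structure (L : language) := Structure {
  carrier :> Type;
  carrier_nonempty : inhabited carrier;
  finterp : forall f : fsym L, ('I_(farity f) -> carrier) -> carrier;
  rinterp : forall r : rsym L, ('I_(rarity r) -> carrier) -> Prop }.

Section Semantics.
Variables (L : language) (M : structure L).

Fixpoint eval (V : Type) (e : V -> M) (t : term L V) : M :=
  match t with
  | Var v => e v
  | App f args => finterp (fun i => eval e (args i))
  end.

Fixpoint sat (V : Type) (phi : form L V) : (V -> M) -> Prop :=
  match phi with
  | Bot => fun _ => False
  | Eq t u => fun e => eval e t = eval e u
  | Rel r args => fun e => rinterp (fun i => eval e (args i))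
  | Imp phi1 phi2 => fun e => sat phi1 e -> sat phi2 e
  | All phi1 => fun e => forall x : M,
      sat phi1 (fun o => if o is Some v then e v else x)
  end.

End Semantics.

Definition sentence (L : language) := form L void.
Definition theory (L : language) := set (sentence L).

Definition holds (L : language) (M : structure L) (phi : sentence L) : Prop :=
  sat phi (of_void M).

Definition model (L : language) (T : theory L) (M : structure L) : Prop :=
  forall phi, T phi -> holds M phi.

Definition Th (L : language) (M : structure L) : theory L := [set phi | holds M phi].

Definition entails (L : language) (T : theory L) (phi : sentence L) : Prop :=
  forall M : structure L, model T M -> holds M phi.

Definition complete_theory (L : language) (T : theory L) : Prop :=
  (exists M : structure L, model T M) /\
  (forall phi, entails T phi \/ entails T (Neg phi)).

Definition completion (L : language) (T T' : theory L) : Prop :=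
  complete_theory T' /\ T `<=` T'.

Definition has_infinite_models (L : language) (T : theory L) : Prop :=
  exists M : structure L, model T M /\ infinite_set [set: M].

(** * Monster models *)

(** The cardinal "kappa hat" is given by a type [kappa] of that size. *)
Definition small (kappa X : Type) (A : set X) : Prop :=
  (A #<= [set: kappa]) && ~~ ([set: kappa] #<= A).

Definition elementary_embedding (L : language) (M N : structure L) (h : M -> N) : Prop :=
  forall (V : Type) (phi : form L V) (e : V -> M), sat phi e <-> sat phi (h \o e).

Definition automorphism (L : language) (M : structure L) (s : M -> M) : Prop :=
  [/\ bijective s,
      forall (f : fsym L) (x : 'I_(farity f) -> M), s (finterp x) = finterp (s \o x) &
      forall (r : rsym L) (x : 'I_(rarity r) -> M), rinterp x <-> rinterp (s \o x)].

Definition universal (L : language) (kappa : Type) (T : theory L) (U : structure L) : Prop :=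
  forall M : structure L, model T M -> small kappa [set: M] ->
    exists h : M -> U, elementary_embedding h.

Definition strongly_homogeneous (L : language) (kappa : Type) (U : structure L) : Prop :=
  forall (X : Type) (a b : X -> U), small kappa [set: X] ->
    (forall phi : form L X, sat phi a <-> sat phi b) ->
    exists s : U -> U, automorphism s /\ s \o a = b.

Definition sufficiently_large (L : language) (kappa : Type) : Prop :=
  [/\ small kappa [set: nat], small kappa [set: fsym L] & small kappa [set: rsym L]].

Definition monster (L : language) (kappa : Type) (T : theory L) (U : structure L) : Prop :=
  [/\ sufficiently_large L kappa, model T U, universal kappa T U &
      strongly_homogeneous kappa U].

(** * Naming parameters *)

Definition lang_with (L : language) (X : Type) : language :=
  {| fsym := (fsym L + X)%type;
     farity := fun f => match f with inl g => farity g | inr _ => 0 end;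
     rsym := rsym L;
     rarity := @rarity L |}.

Definition expand (L : language) (U : structure L) (B : set U) :
    structure (lang_with L (set_type B)) :=
  @Structure (lang_with L (set_type B)) U (carrier_nonempty U)
    (fun f : fsym (lang_with L (set_type B)) =>
       match f return ('I_(@farity (lang_with L (set_type B)) f) -> U) -> U with
       | inl g => fun x => @finterp L U g x
       | inr c => fun _ => set_val c
       end)
    (fun (r : rsym L) x => @rinterp L U r x).

Definition theory_over (L : language) (U : structure L) (B : set U) :
    theory (lang_with L (set_type B)) :=
  Th (expand B).

Arguments theory_over {L U} B.

(** * EM-types and indiscernible sequences *)

(** A tuple of size [|K|] is a function on [K].  The index set of a sequence
    is a type [J] with a strict order [lt]. *)

(** The formulas in the [K]-tuples of variables [x_0, ..., x_(n-1)]; the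
    variable [(k, i)] is the [i]-th coordinate of [x_k]. *)
Definition EM_form (L : language) (K : Type) (n : nat) := form L ('I_n * K)%type.

Section EM.
Variables (L : language) (U : structure L) (K J : Type) (lt : J -> J -> Prop).
Variable b : J -> K -> U.

Definition increasing (n : nat) (s : 'I_n -> J) : Prop :=
  forall k l : 'I_n, (k < l)%N -> lt (s k) (s l).

Definition EM_sat (n : nat) (phi : EM_form L K n) : Prop :=
  forall s : 'I_n -> J, increasing s -> sat phi (fun v => b (s v.1) v.2).

(** Each formula comes with its list of variables [x_0, ..., x_(n-1)], so a
    set of formulas in [(x_k : k < omega)] is a family indexed by [n]. *)
Definition EM_type : forall n, set (EM_form L K n) :=
  fun n => [set phi | EM_sat phi].

Definition indiscernible : Prop :=
  forall n (phi : EM_form L K n), EM_type phi \/ EM_type (Neg phi).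

End EM.

Definition ord_lt (d : Order.disp_t) (I : orderType d) : I -> I -> Prop :=
  fun x y => (x < y)%O.

Definition complete_EM_type (L : language) (kappa : Type) (U : structure L) (K : Type)
    (Gamma : forall n, set (EM_form L K n)) : Prop :=
  exists (d : Order.disp_t) (I : orderType d) (b : I -> K -> U),
    [/\ infinite_set [set: I], small kappa [set: I],
        indiscernible (@ord_lt d I) b & Gamma = EM_type (@ord_lt d I) b].

(** * Dedekind partitions and insertion *)

Section Dedekind.
Variables (d : Order.disp_t) (I : orderType d) (n : nat) (P : 'I_n.+1 -> set I).

Definition convex (S : set I) : Prop :=
  forall x y z, S x -> S z -> (x <= y)%O -> (y <= z)%O -> S y.

Definition convex_partition : Prop :=
  [/\ forall i, P i !=set0,
      forall i, convex (P i),
      forall x, exists i, P i x &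
      forall (i j : 'I_n.+1) x y, (i < j)%N -> P i x -> P j y -> (x < y)%O].

Definition lower (i : 'I_n) : set I := \bigcup_(j in [set j : 'I_n.+1 | (j <= i)%N]) P j.
Definition upper (i : 'I_n) : set I := \bigcup_(j in [set j : 'I_n.+1 | (i < j)%N]) P j.

Definition dedekind_partition : Prop :=
  convex_partition /\
  forall i : 'I_n,
    ~ (exists x, lower i x /\ forall y, lower i y -> (y <= x)%O) /\
    ~ (exists x, upper i x /\ forall y, upper i y -> (x <= y)%O).

(** A subsequence of [(a_0, ..., a_(n-1))] is given by its set [D] of indices;
    the index [inr i] is placed at the [i]-th cut. *)
Definition insert_lt (D : {set 'I_n}) (x y : I + {i : 'I_n | i \in D}) : Prop :=
  match x, y with
  | inl u, inl v => (u < v)%O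
  | inl u, inr i => lower (sval i) u
  | inr i, inl v => upper (sval i) v
  | inr i, inr j => (sval i < sval j)%N
  end.

Variables (L : language) (U : structure L) (K : Type) (b : I -> K -> U).

Definition insert_seq (A : 'I_n -> K -> U) (D : {set 'I_n})
    (x : I + {i : 'I_n | i \in D}) : K -> U :=
  match x with inl u => b u | inr i => A (sval i) end.

Definition inserts (A : 'I_n -> K -> U) (D : {set 'I_n}) : Prop :=
  indiscernible (@insert_lt D) (@insert_seq A D).

Definition distal_partition (m : nat) : Prop :=
  forall A : 'I_n -> K -> U,
    ~ inserts A [set: 'I_n]%SET ->
    exists D : {set 'I_n}, #|D| = m /\ ~ inserts A D.

End Dedekind.

(** * Distality rank *)

Definition distal_EM_type (L : language) (kappa : Type) (U : structure L) (K : Type)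
    (m : nat) (Gamma : forall n, set (EM_form L K n)) : Prop :=
  forall (d : Order.disp_t) (I : orderType d) (b : I -> K -> U) (P : 'I_m.+2 -> set I),
    small kappa [set: I] -> indiscernible (@ord_lt d I) b ->
    EM_type (@ord_lt d I) b = Gamma -> dedekind_partition P ->
    distal_partition P b m.

Definition distal_theory (L : language) (kappa : Type) (m : nat) (T : theory L) : Prop :=
  forall (T' : theory L) (U : structure L), completion T T' -> monster kappa T' U ->
  forall K : Type, small kappa [set: K] ->
  forall Gamma : (forall n, set (EM_form L K n)),
    complete_EM_type kappa U Gamma -> distal_EM_type kappa U m Gamma.

(** The value [None] stands for [omega]. *)
Definition DR (L : language) (kappa : Type) (T : theory L) : option nat :=
  match pselect (exists m, (0 < m)%N && `[< distal_theory kappa m T >]) with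
  | left ex => Some (ex_minn ex)
  | right _ => None
  end.

Definition rank_le (r s : option nat) : Prop :=
  match r, s with
  | _, None => True
  | Some m, Some n => (m <= n)%N
  | None, Some _ => False
  end.

(* Main.v *)
(** Let [V] be a monster model of [T_B] with a Dedekind partition of an
    [L_B]-indiscernible sequence and candidates [A] for insertion.  Appending to
    every tuple an enumeration of the constants turns [L_B]-indiscernibility into
    [L]-indiscernibility, so it suffices to apply the distality of [T] to the
    extended tuples.  The [L]-reduct of [V] need not be strongly homogeneous,
    hence need not be a monster model of [T]; but the tuples involved lie in a
    small [L]-elementary substructure (downward Loewenheim-Skolem), which embeds
    into the given monster model [U] of [T] by universality. *)

Require Import Defs.
From mathcomp Require Import all_boot all_order.
From mathcomp Require Import boolp classical_sets functions cardinality.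
(* [fsym] must denote the function symbols of a language, not [ssrfun.fsym]. *)
Import Defs.
Import Order.TTheory.

Set Implicit Arguments.
Unset Strict Implicit.
Unset Printing Implicit Defensive.

Local Open Scope classical_set_scope.
Local Open Scope card_scope.

(** * Cardinal arithmetic *)

Definition embeds (X Y : Type) : Prop := exists f : X -> Y, injective f.

Lemma embeds_trans X Y Z : embeds X Y -> embeds Y Z -> embeds X Z.
Proof. by move=> [f fI] [g gI]; exists (g \o f); exact: inj_comp. Qed.

Lemma embeds_card X Y : embeds X Y <-> [set: X] #<= [set: Y].
Proof.
split=> [[f fI]|/card_leP/injfunPex[f _ fI]].
  apply/card_leP/injfunPex; exists (fun x => SigSub (in_setT (f (val x)))) => //.
  by move=> x y _ _ /(congr1 val) /fI /val_inj.
exists (fun x => val (f (SigSub (in_setT x)))) => x y /val_inj e.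
by have /(congr1 val) := fI _ _ (in_setT _) (in_setT _) e.
Qed.

Lemma chain_pair T (F : set (set T)) G H x y : total_on F subset ->
  F G -> F H -> G x -> H y -> exists K, [/\ F K, K x & K y].
Proof.
move=> tF FG FH Gx Hy; case: (tF _ _ FG FH) => GH.
  by exists H; split=> //; apply: GH.
by exists G; split=> //; apply: GH.
Qed.

(** Zorn's lemma for graphs of partial injections, the equivalence in [pinj] saying both
    single-valued and injective. If a maximal graph missed some [x] and some [y], adding the pair
    [(x, y)] would enlarge it. *)
Lemma embeds_total X Y : embeds X Y \/ embeds Y X.
Proof.
pose pinj := [set G : set (X * Y) |
  forall p q, G p -> G q -> p.1 = q.1 <-> p.2 = q.2].
have [|G [Ginj Gmax]] := @Zorn_bigcup _ pinj.
  move=> F FP tF p q [G FG Gp] [H FH Hq].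
  by have [K [FK Kp Kq]] := chain_pair tF FG FH Gp Hq; exact: (FP K).
case: (pselect (forall x, exists y, G (x, y))) => [/choice[f Gf]|/existsNP[x nx]].
  by left; exists f => x x' e; apply/(Ginj _ _ (Gf x) (Gf x')).
case: (pselect (forall y, exists x, G (x, y))) => [/choice[f Gf]|/existsNP[y ny]].
  by right; exists f => y y' e; apply/(Ginj _ _ (Gf y) (Gf y')).
exfalso; apply: (Gmax (G `|` [set (x, y)])).
  split; first exact: subsetUl.
  by move=> /(_ (x, y)) /(_ (or_intror erefl)) Gxy; apply: nx; exists y.
have new_ne p : G p -> x <> p.1 /\ y <> p.2.
  by case: p => a b /= Gp; split=> e; [apply: nx; exists b|apply: ny; exists a];
    rewrite e.
move=> p q [Gp|->] [Gq|->] //=; first exact: Ginj.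
- by have [xp yp] := new_ne _ Gp; split=> e; [case: xp|case: yp].
- by have [xp yp] := new_ne _ Gq; split=> e; [case: xp|case: yp].
Qed.

Section Square.
Variable Z : Type.
Implicit Types M G : set (Z * Z * Z).

Let dom M : set Z := [set x | exists z, M (x, x, z)].

(* [pairing M]: [M] is the graph of an injection from [A * A] to [A], where [A = dom M]. *)
Let pairing M : Prop :=
  [/\ forall p q, M p -> M q -> p.1 = q.1 <-> p.2 = q.2,
      forall x y, dom M x -> dom M y -> exists z, M (x, y, z) &
      forall x y z, M (x, y, z) -> [/\ dom M x, dom M y & dom M z]].

Let pairing_bigcup (F : set (set (Z * Z * Z))) :
  F `<=` pairing -> total_on F subset -> pairing (\bigcup_(G in F) G).
Proof.
move=> FP tF.
have domF x : dom (\bigcup_(G in F) G) x <-> exists2 G, F G & dom G x.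
  by split=> [[z [G FG Gz]]|[G FG [z Gz]]]; [exists G => //; exists z|exists z, G].
split=> [p q [G FG Gp] [H FH Hq]|x y /domF[G FG [z Gx]] /domF[H FH [t Hy]]|x y z [G FG Gxy]].
- have [K [FK Kp Kq]] := chain_pair tF FG FH Gp Hq.
  by have [+ _ _] := FP _ FK; exact.
- have [K [FK Kx Ky]] := chain_pair tF FG FH Gx Hy.
  have [_ + _] := FP _ FK => /(_ x y)[||u Ku]; first by exists z.
    by exists t.
  by exists u, K.
- have [_ _ /(_ _ _ _ Gxy)[dx dy dz]] := FP _ FG.
  by split; apply/domF; exists G.
Qed.

(* In a maximal pairing [M], extending one on a countable set, either the
   complement of [A = dom M] embeds into [A], and then so does [Z]; or [A] has a
   disjoint copy [g A], and [M] extends to [A] and [g A] together by sending the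
   new pairs into [g A]. *)
Lemma embeds_square : embeds nat Z -> embeds (Z * Z) Z.
Proof.
move=> [i iI].
pose M0 : set (Z * Z * Z) :=
  [set p | exists a b, p = (i a, i b, i (pickle (a, b)))].
have dom0 x : dom M0 x <-> exists a, x = i a.
  split=> [[z [a [b [-> _ _]]]]|[a ->]]; first by exists a.
  by exists (i (pickle (a, a))), a, a.
have pairing0 : pairing M0.
  split=> [_ _ [a [b ->]] [c [e ->]]|_ _ /dom0[a ->] /dom0[b ->]|x y z [a [b [-> -> ->]]]].
  - split=> [[/iI -> /iI ->] //|/iI /(pcan_inj pickleK) [-> ->]] //.
  - by exists (i (pickle (a, b))), a, b.
  - by split; apply/dom0; eexists.
(* Taking the union with [M0] inside the predicate forces the maximal pairing to contain [M0], and
   also covers the empty chain. *)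
have [|G [PG Gmax]] := @Zorn_bigcup _ [set G | pairing (M0 `|` G)].
  move=> F FP tF /=.
  have -> : M0 `|` \bigcup_(G in F) G =
            \bigcup_(H in [set M0] `|` [set M0 `|` G | G in F]) H.
    apply/seteqP; split=> [p [Mp|[H FH Hp]]|p [H [->|[K FK <-]]]].
    - by exists M0 => //; left.
    - by exists (M0 `|` H); [right; exists H|right].
    - by left.
    - by move=> [|Kp]; [left|right; exists K].
  apply: pairing_bigcup => [H [->|[K FK <-]]|]; [exact: pairing0|exact: FP|].
  move=> _ _ [->|[K FK <-]] [->|[H FH <-]]; [by left|left|right|]; try exact: subsetUl.
  by case: (tF _ _ FK FH) => KH; [left|right]; apply: setUS.
set M := M0 `|` G in PG; have [Mfun Mtot Mdom] := PG.
pose A := {x : Z | dom M x}.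
have domi a : dom M (i a) by exists (i (pickle (a, a))); left; exists a, a.
have [f Mf] : {f : A * A -> A & forall p, M (sval p.1, sval p.2, sval (f p))}.
  apply: (@choice _ _ (fun p c => M (sval p.1, sval p.2, sval c))) => -[[x dx] [y dy]] /=.
  have [z Mz] := Mtot _ _ dx dy; have [_ _ dz] := Mdom _ _ _ Mz.
  by exists (exist _ z dz).
have val_inj (a b : A) : sval a = sval b -> a = b by exact: eq_sig_hprop.
have fI : injective f.
  move=> p q e; have /= := Mfun _ _ (Mf p) (Mf q); rewrite e => -[_ /(_ erefl)].
  by case: p q {e} => [a b] [c e] /= [/val_inj -> /val_inj ->].
have [tag tagI] : exists tag : bool -> A, injective tag.
  exists (fun s => exist _ (i s) (domi s)).
  by move=> s t /(congr1 sval) /iI; case: s t => -[].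
case: (embeds_total {x | ~ dom M x} A) => -[g gI].
  have [h hI] : embeds Z A.
    (* The tag keeps the images of [A] and of its complement apart. The inner default [tag true] is
       never reached, since that branch has [~ dom M x]. *)
    exists (fun x => if pselect (dom M x) is left dx
      then f (tag true, exist _ x dx) else
      f (tag false, if pselect (dom M x) is right nx then g (exist _ x nx) else tag true)).
    move=> x y; case: pselect => dx; case: pselect => dy /fI e;
      have /= /tagI := congr1 fst e => // _; have /= := congr1 snd e; first by case.
    by move=> /gI [].
  exists (fun p => sval (f (h p.1, h p.2))) => -[x y] [x' y'].
  by move=> /val_inj /fI [/hI -> /hI ->].
pose inc (s : bool) (a : A) : Z := if s then sval a else sval (g a).
have incI s t a b : inc s a = inc t b -> s = t /\ a = b.
  case: s t => -[] /= e; [by split=> //; exact: val_inj| | |].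
  - by case: (svalP (g b)); rewrite -e; exact: svalP.
  - by case: (svalP (g a)); rewrite e; exact: svalP.
  - by split=> //; apply: gI; exact: eq_sig_hprop.
exfalso.
(* Pairs inside [A] keep their old code. For the three other kinds, [f] packs the kind [(s, t)] with
   the code of [(a, b)], and [inc (s && t)] then moves the result into the copy [g A]. *)
pose code s t a b := f (if s && t then (a, b) else (f (tag s, tag t), f (a, b))).
pose new : set (Z * Z * Z) := [set p | exists s t a b, ~~ (s && t) /\
  p = (inc s a, inc t b, inc (s && t) (code s t a b))].
have Minc p : (M `|` new) p <->
    exists s t a b, p = (inc s a, inc t b, inc (s && t) (code s t a b)).
  split=> [[|[s [t [a [b [_ ->]]]]]]|[s [t [a [b ->]]]]].
  - case: p => -[x y] z Mp; have [dx dy dz] := Mdom _ _ _ Mp.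
    exists true, true, (exist _ x dx), (exist _ y dy) => /=.
    have := Mfun _ _ Mp (Mf (exist _ x dx, exist _ y dy)).
    by move=> /= [/(_ erefl) -> _].
  - by exists s, t, a, b.
  - case: (boolP (s && t)) => st; last by right; exists s, t, a, b; rewrite (negbTE st).
    by left; rewrite /code; case/andP: st => -> -> /=; exact: (Mf (a, b)).
have dom_inc x : dom (M `|` new) x <-> exists s a, x = inc s a.
  split=> [[z /Minc[s [t [a [b [-> _ _]]]]]]|[s [a ->]]]; first by exists s, a.
  by eexists; apply/Minc; exists s, s, a, a.
apply: (Gmax (M `|` new)).
  split; first by move=> p Gp; left; right.
  move=> sub; have /sub Gp : (M `|` new) (inc false (tag true), inc false (tag true),
      inc false (code false false (tag true) (tag true))).
    by right; exists false, false, (tag true), (tag true).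
  case: (svalP (g (tag true))).
  by have [] := Mdom _ _ _ (or_intror Gp).
rewrite /= setUA (_ : M0 `|` M = M); last by rewrite setUA setUid.
split.
- move=> _ _ /Minc[s [t [a [b ->]]]] /Minc[s' [t' [a' [b' ->]]]] /=; split.
    by move=> [/incI[-> ->] /incI[-> ->]].
  move=> /incI[e] /fI; rewrite -e; case: ifP => [/andP[s1 t1]|_] [].
    by move: e; rewrite s1 t1 => /esym/andP[-> ->] -> ->.
  by move=> /fI[/tagI -> /tagI ->] /fI[-> ->].
- move=> x y /dom_inc[s [a ->]] /dom_inc[t [b ->]].
  by eexists; apply/Minc; exists s, t, a, b.
- move=> x y z /Minc[s [t [a [b [-> -> ->]]]]]; split; apply/dom_inc;
    [by exists s, a|by exists t, b|].
  by eexists; eexists.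
Qed.

End Square.

Lemma small_embeds kappa X Y :
  embeds X Y -> small kappa [set: Y] -> small kappa [set: X].
Proof.
move=> XY /andP[/embeds_card Yk /negP kY]; apply/andP; split.
  by apply/embeds_card; exact: embeds_trans XY Yk.
by apply/negP => /embeds_card kX; apply/kY/embeds_card; exact: embeds_trans kX XY.
Qed.

Lemma small_set_type kappa X (A : set X) : small kappa A -> small kappa [set: set_type A].
Proof.
rewrite /small => /andP[Ak kA]; apply/andP; split.
  by rewrite (card_le_eql (card_setT A)).
by rewrite (card_le_eqr (card_setT A)).
Qed.

(** By comparability the larger type is itself a bound; iterating gives one small bound for finitely
    many types. *)
Lemma small_join kappa X Y : small kappa [set: X] -> small kappa [set: Y] ->
  exists Z, [/\ small kappa [set: Z], embeds X Z & embeds Y Z].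
Proof.
have embxx W : embeds W W by exists id.
by move=> sX sY; case: (embeds_total X Y) => ?; [exists Y|exists X].
Qed.

Section InfiniteCardinal.
Variable Z : Type.
Hypothesis natZ : embeds nat Z.

Lemma embeds_prod X Y : embeds X Z -> embeds Y Z -> embeds (X * Y) Z.
Proof.
move=> [f fI] [g gI]; apply: embeds_trans (embeds_square natZ).
by exists (fun p => (f p.1, g p.2)) => -[x y] [x' y'] [/fI -> /gI ->].
Qed.

Lemma embeds_sum X Y : embeds X Z -> embeds Y Z -> embeds (X + Y) Z.
Proof.
move=> [f fI] [g gI]; have [i iI] := natZ.
apply: embeds_trans (embeds_prod natZ (ex_intro _ _ (@inj_id Z))).
exists (fun s => match s with inl x => (0, f x) | inr y => (1, g y) end).
by move=> [x|y] [x'|y'] // [] => [/fI ->|/gI ->].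
Qed.

Lemma embeds_seq X : embeds X Z -> embeds (seq X) Z.
Proof.
move=> XZ; have [i iI] := natZ; have [j jI] := embeds_prod XZ (ex_intro _ _ (@inj_id Z)).
pose c := foldr (fun x z => j (x, z)) (i 0).
apply: embeds_trans (embeds_prod natZ (ex_intro _ _ (@inj_id Z))).
(* The length is recorded because [c] alone need not be injective: [i 0] may be a value of [j]. *)
exists (fun s => (size s, c s)).
elim=> [|x s IH] [|y t] //= [st /jI[-> cst]].
by have -> : s = t by apply: IH; rewrite st cst.
Qed.

Lemma embeds_tree X : embeds X Z -> embeds (GenTree.tree X) Z.
Proof.
move=> XZ; apply: embeds_trans (embeds_seq (embeds_sum natZ XZ)).
by exists (@GenTree.encode X); exact: pcan_inj (GenTree.codeK X).
Qed.

End InfiniteCardinal.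

Lemma small_prod kappa X Y : small kappa [set: nat] ->
  small kappa [set: X] -> small kappa [set: Y] -> small kappa [set: X * Y].
Proof.
move=> sN sX sY; have [V [sV XV YV]] := small_join sX sY.
have [Z [sZ VZ NZ]] := small_join sV sN.
by apply: small_embeds sZ; apply: embeds_prod => //; apply: embeds_trans VZ.
Qed.

Lemma small_sum kappa X Y : small kappa [set: nat] ->
  small kappa [set: X] -> small kappa [set: Y] -> small kappa [set: X + Y].
Proof.
move=> sN sX sY; have [V [sV XV YV]] := small_join sX sY.
have [Z [sZ VZ NZ]] := small_join sV sN.
by apply: small_embeds sZ; apply: embeds_sum => //; apply: embeds_trans VZ.
Qed.

(** * The number of formulas *)

Section EncodeFormulas.
Variables (L : language) (Z : Type).
Variables (cf : fsym L -> Z) (cr : rsym L -> Z).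
Hypotheses (cfI : injective cf) (crI : injective cr).
Local Notation tree := (GenTree.tree Z).

Fixpoint encode_term (V : Type) (ev : V -> tree) (t : term L V) : tree :=
  match t with
  | Var v => GenTree.Node 0 [:: ev v]
  | App f args => GenTree.Node 1
      (GenTree.Leaf (cf f) :: [seq encode_term ev (args i) | i <- enum 'I_(farity f)])
  end.

Definition encode_option (V : Type) (ev : V -> tree) (o : option V) : tree :=
  if o is Some v then GenTree.Node 0 [:: ev v] else GenTree.Node 1 [::].

(** Variables are coded by trees and not by elements of [Z]: below a quantifier the variable type
    grows to [option V], and an injection into trees extends to it by [encode_option]. *)
Fixpoint encode_form (V : Type) (phi : form L V) : (V -> tree) -> tree :=
  match phi with
  | Bot => fun ev => GenTree.Node 0 [::]
  | Eq t u => fun ev => GenTree.Node 1 [:: encode_term ev t; encode_term ev u]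
  | Rel r args => fun ev => GenTree.Node 2
      (GenTree.Leaf (cr r) :: [seq encode_term ev (args i) | i <- enum 'I_(rarity r)])
  | Imp phi1 phi2 => fun ev => GenTree.Node 3 [:: encode_form phi1 ev; encode_form phi2 ev]
  | All phi1 => fun ev => GenTree.Node 4 [:: encode_form phi1 (encode_option ev)]
  end.

Lemma encode_term_inj (V : Type) (ev : V -> tree) : injective ev -> injective (encode_term ev).
Proof.
move=> evI; elim=> [v|f args IH] [w|g args'] //= [].
  by move=> /evI ->.
move=> /cfI fg; subst g => /eq_in_map e.
by congr App; apply/funext => i; apply/IH/e; rewrite mem_enum.
Qed.

Lemma encode_form_inj (V : Type) (ev : V -> tree) :
  injective ev -> injective (fun phi => encode_form phi ev).
Proof.
move=> + phi; elim: phi ev => {V} [V|V t u|V r args|V phi1 IH1 phi2 IH2|V phi1 IH] ev evI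
  [|t' u'|r' args'|phi1' phi2'|phi1'] //= [].
- by move=> /(encode_term_inj evI) -> /(encode_term_inj evI) ->.
- move=> /crI rr; subst r' => /eq_in_map e.
  congr Rel; apply/funext => i; apply: (encode_term_inj evI); apply: e.
  by rewrite mem_enum.
- by move=> /(IH1 _ evI) -> /(IH2 _ evI) ->.
- by move=> /IH -> // [v|] [w|] //= [/evI ->].
Qed.

End EncodeFormulas.

Lemma embeds_form (L : language) (V Z : Type) :
  embeds nat Z -> embeds (fsym L) Z -> embeds (rsym L) Z ->
  embeds V Z -> embeds (form L V) Z.
Proof.
move=> NZ [cf cfI] [cr crI] [ev evI].
apply: embeds_trans (embeds_tree NZ (ex_intro _ _ (@inj_id Z))).
exists (fun phi => encode_form cf cr phi (fun v => GenTree.Leaf (ev v))).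
by apply: encode_form_inj => // v w [/evI].
Qed.

(** * Elementary substructures *)

Fixpoint rename_term (L : language) (V W : Type) (r : V -> W) (t : term L V) : term L W :=
  match t with
  | Var v => Var L (r v)
  | App f args => App (fun i => rename_term r (args i))
  end.

Fixpoint rename (L : language) (V : Type) (phi : form L V) :
    forall W : Type, (V -> W) -> form L W :=
  match phi with
  | Bot => fun W r => Bot
  | Eq t u => fun W r => Eq (rename_term r t) (rename_term r u)
  | Rel R args => fun W r => Rel (fun i => rename_term r (args i))
  | Imp phi1 phi2 => fun W r => Imp (rename phi1 r) (rename phi2 r)
  | All phi1 => fun W r => All (rename phi1 (omap r))
  end.

Lemma eval_rename (L : language) (M : structure L) (V W : Type) (r : V -> W)
    (e : W -> M) (t : term L V) :
  eval e (rename_term r t) = eval (e \o r) t.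
Proof. by elim: t => //= f args IH; congr finterp; apply/funext. Qed.

Lemma sat_rename (L : language) (M : structure L) (V W : Type) (r : V -> W)
    (e : W -> M) (phi : form L V) :
  sat (rename phi r) e <-> sat phi (e \o r).
Proof.
elim: phi W r e => {V} [V|V t u|V R args|V phi1 IH1 phi2 IH2|V phi IH] W r e //=.
- by rewrite !eval_rename.
- have -> // : (fun i => eval e (rename_term r (args i))) =
               (fun i => eval (e \o r) (args i)).
  by apply/funext => i; rewrite eval_rename.
- by rewrite IH1 IH2.
- have E x : (fun o => if o is Some v then e v else x) \o omap r =
             (fun o => if o is Some v then (e \o r) v else x).
    by apply/funext => -[].
  by split=> sphi x; [rewrite -E -IH|rewrite IH E].
Qed.

(* Formulas have finite support: of the levels of its variables, only finitely
   many matter. *)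
Lemma eval_finite_support (L : language) (V : Type) (lev : V -> nat) (t : term L V) :
  exists n, forall (M : structure L) (e e' : V -> M),
    (forall v, lev v <= n -> e v = e' v) -> eval e t = eval e' t.
Proof.
elim: t => [v|f args /choice[n nP]] /=.
  by exists (lev v) => M e e'; apply.
exists (\max_i n i) => M e e' ee'; congr finterp; apply/funext => i.
by apply: nP => v vn; apply: ee'; exact: leq_trans vn (leq_bigmax i).
Qed.

Lemma sat_finite_support (L : language) (V : Type) (lev : V -> nat) (phi : form L V) :
  exists n, forall (M : structure L) (e e' : V -> M),
    (forall v, lev v <= n -> e v = e' v) -> sat phi e <-> sat phi e'.
Proof.
elim: phi lev => {V} [V|V t u|V R args|V phi1 IH1 phi2 IH2|V phi IH] lev /=.
- by exists 0.
- have [n nP] := eval_finite_support lev t.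
  have [m mP] := eval_finite_support lev u.
  exists (maxn n m) => M e e' ee'.
  rewrite (nP M e e') ?(mP M e e') // => v vn; apply: ee'; rewrite leq_max vn ?orbT //.
- have /choice[n nP] := fun i => eval_finite_support lev (args i).
  exists (\max_i n i) => M e e' ee'.
  have -> // : (fun i => eval e (args i)) = (fun i => eval e' (args i)).
  apply/funext => i; apply: nP => v vn; apply: ee'.
  exact: leq_trans vn (leq_bigmax i).
- have [n nP] := IH1 lev; have [m mP] := IH2 lev.
  exists (maxn n m) => M e e' ee'.
  rewrite (nP M e e') ?(mP M e e') // => v vn; apply: ee'; rewrite leq_max vn ?orbT //.
(* Any level would do for the bound variable, as both extended valuations give it the same value. *)
- have [n nP] := IH (fun o => if o is Some v then lev v else 0).
  exists n => M e e' ee'.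
  pose ext (f : V -> M) x o := if o is Some v then f v else x.
  have E x : sat phi (ext e x) <-> sat phi (ext e' x) by apply: nP => -[v /ee'|].
  by split=> sphi x; apply/E; exact: sphi.
Qed.

(** * The downward Loewenheim-Skolem theorem *)

Section Hull.
Variables (L : language) (M : structure L) (Z : Type).
Hypotheses (NZ : embeds nat Z) (FZ : embeds (fsym L) Z) (RZ : embeds (rsym L) Z).
Variable p : Z -> M.

Let env X (e : X -> M) (x : M) : option X -> M := fun o => if o is Some v then e v else x.

(** A Tarski-Vaught closure built in countably many stages, each the range of a function on [Z].
    Since [Z] has room for all formulas, the witnesses of a stage can be indexed by formula codes.
    The union is closed because finite support places the relevant parameters of a formula in a
    single stage; this also handles variable types [X] of any size. *)
Lemma exists_hull : exists H : set M,
  [/\ exists h : nat * Z -> M, H = range h, forall z, H (p z) &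
   forall X (phi : form L (option X)) (e : X -> M), (forall v, H (e v)) ->
     (exists x, sat phi (env e x)) -> exists2 x, H x & sat phi (env e x)].
Proof.
have [c cI] : embeds (form L (option Z)) Z.
  apply: embeds_form => //.
  apply: embeds_trans (embeds_sum NZ NZ (ex_intro _ _ (@inj_id Z))).
  exists (fun o => if o is Some z then inr z else inl 0).
  by move=> [x|] [y|] // [->].
(* [q'] realizes every formula over the values of [q] that can be realized. *)
have step (q : Z -> M) : exists q' : Z -> M, forall phi : form L (option Z),
    (exists x, sat phi (env q x)) -> exists z, sat phi (env q (q' z)).
  have [m] := carrier_nonempty M.
  have /choice[q' qP] z : exists x, forall phi, c phi = z ->
      (exists x, sat phi (env q x)) -> sat phi (env q x).
    case: (pselect (exists phi, c phi = z /\ exists x, sat phi (env q x))).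
      by move=> [phi [<- [x sx]]]; exists x => psi /cI ->.
    by move=> nphi; exists m => phi cz sx; case: nphi; exists phi.
  by exists q' => phi sx; exists (c phi); exact: qP.
have /choice[next nextP] := step.
pose q n := iter n next p; pose H n : set M := range (q n).
have HS n : H n `<=` H n.+1.
  move=> _ [z _ <-].
  (* The formula stating that the new element equals [q n z] is realizable, so the next stage
     contains [q n z]. *)
  have [|z' /= e] := nextP (q n) (Eq (Var L None) (Var L (Some z))); first by exists (q n z).
  by exists z'.
have Hmono n m : n <= m -> H n `<=` H m.
  by move=> /subnK <-; elim: (m - n) => //= k IH; apply: subset_trans IH (HS _).
exists (range (fun nz : nat * Z => q nz.1 nz.2)); split; first by eexists.
  by move=> z; exists (0, z).
move=> X phi e He sx.
have /choice[lev levP] x : exists n, H n (e x).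
  by have [[n z] _ <-] := He x; exists n, z.
have [n nP] := sat_finite_support (fun o => if o is Some v then lev v else 0) phi.
have [m] := carrier_nonempty M; have [i iI] := NZ.
(* Parameters of level at most [n] are replaced by indices into stage [n]. The others get the
   default [i 0], which by the choice of [n] does not affect satisfaction. *)
have /choice[r rP] x : exists z, lev x <= n -> q n z = e x.
  case: (leqP (lev x) n) => // xn; last by exists (i 0).
  by have [z _ ez] := Hmono _ _ xn _ (levP x); exists z.
have E x : sat phi (env e x) <-> sat (rename phi (omap r)) (env (q n) x).
  rewrite sat_rename; apply: nP => -[v /= /rP|] //.
have [|z sz] := nextP (q n) (rename phi (omap r)).
  by case: sx => x /E; exists x.
exists (q n.+1 z); last by apply/E.
by exists (n.+1, z).
Qed.

Lemma exists_elementary_substructure : exists (N : structure L) (j : N -> M),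
  [/\ embeds N Z, elementary_embedding j & forall z, exists x, j x = p z].
Proof.
have [H [[h Hh] Hp HTV]] := exists_hull.
have [i iI] := NZ.
have Hf (f : fsym L) (x : 'I_(farity f) -> {x | H x}) :
    H (finterp (fun k => sval (x k))).
  (* Closure under [f]: the only witness of the formula stating that the new element is the value of
     [f] is that value. *)
  have [||y Hy /= <- //] := HTV _ (Eq (Var L None) (App (fun k => Var L (Some k))))
    (fun k => sval (x k)).
    by move=> k; exact: (svalP (x k)).
  by exists (finterp (fun k => sval (x k))).
pose N := @Structure L {x | H x} (inhabits (exist _ _ (Hp (i 0))))
  (fun f x => exist _ _ (Hf f x)) (fun r x => rinterp (fun k => sval (x k))).
have evalN V (e : V -> N) (t : term L V) : sval (eval e t) = eval (sval \o e) t.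
  by elim: t => //= f args IH; congr finterp; apply/funext.
exists N, sval; split=> [||z]; last by exists (exist _ _ (Hp z)).
- have [nz nzI] := embeds_prod NZ NZ (ex_intro _ _ (@inj_id Z)).
  have /choice[g gP] (x : N) : exists k, h k = sval x.
    by case: x => x /=; rewrite Hh => -[k _ <-]; exists k.
  exists (nz \o g) => x y /nzI /(congr1 h); rewrite !gP => xy.
  exact: eq_sig_hprop.
- move=> V phi; elim: phi => {V} [V|V t u|V R args|V phi1 IH1 phi2 IH2|V phi IH] e //=.
  + by rewrite -!evalN; split=> [->//|]; exact: eq_sig_hprop.
  + have -> // : (fun k => sval (eval e (args k))) = (fun k => eval (sval \o e) (args k)).
    by apply/funext => k; rewrite evalN.
  + by rewrite IH1 IH2.
  + have E (x : N) : sval \o (fun o => if o is Some v then e v else x) =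
        env (sval \o e) (sval x).
      by apply/funext => -[].
    split=> sphi x; last by apply/IH; rewrite E; exact: sphi.
    apply: contrapT => nphi.
    (* The Tarski-Vaught test: a counterexample in [M] yields one in the hull. *)
    have [||y Hy] := HTV _ (Neg phi) (sval \o e).
    * by move=> v; exact: (svalP (e v)).
    * by exists x.
    * by move=> []; rewrite -[y]/(sval (exist _ y Hy : N)) -E; apply/IH; exact: sphi.
Qed.

End Hull.

(** A small model [N] containing the tuple embeds elementarily into [M] by [j] and into [U] by [h];
    the tuple is pulled back along [j] and pushed forward along [h]. *)
Lemma realize_small_tuple (L : language) kappa (T : theory L) (U M : structure L)
    (P : Type) (p : P -> M) :
  sufficiently_large L kappa -> universal kappa T U -> model T M ->
  small kappa [set: P] ->
  exists q : P -> U, forall (W : Type) (phi : form L W) (r : W -> P),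
    sat phi (p \o r) <-> sat phi (q \o r).
Proof.
move=> [sN sF sR] univU MT sP.
have [Z1 [sZ1 NZ1 FZ1]] := small_join sN sF.
have [Z2 [sZ2 RZ2 PZ2]] := small_join sR sP.
have [Z [sZ Z1Z Z2Z]] := small_join sZ1 sZ2.
have [i iI] := embeds_trans PZ2 Z2Z.
have [x0] := carrier_nonempty M.
(* The hull is built around a tuple indexed by [Z]: [p] is transported along [i], with the constant
   value [x0] off its image. *)
have /choice[p' p'P] z : exists y, forall x, i x = z -> p x = y.
  case: (pselect (exists x, i x = z)) => [[x <-]|nx].
    by exists (p x) => x' /iI ->.
  by exists x0 => x xz; case: nx; exists x.
have [N [j [NZ jel jp]]] := exists_elementary_substructure
  (embeds_trans NZ1 Z1Z) (embeds_trans FZ1 Z1Z) (embeds_trans RZ2 Z2Z) p'.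
have NT : model T N.
  move=> phi /MT; rewrite /holds => sphi; apply/jel.
  by rewrite (_ : j \o _ = of_void M) //; apply/funext => -[].
have [h hel] := univU N NT (small_embeds NZ sZ).
have /choice[g gP] x : exists y, j y = p x.
  by have [y jy] := jp (i x); exists y; rewrite jy; exact/esym/p'P.
exists (h \o g) => W phi r.
have -> : p \o r = j \o (g \o r) by apply/funext => w; rewrite /= gP.
by rewrite -(jel _ phi) (hel _ phi).
Qed.

(** * Parameters as variables *)

Section Constants.
Variables (L : language) (X : Type).
Local Notation LX := (lang_with L X).

Definition noargs (S : Type) : 'I_0 -> S := fun i => match notF (ltn_ord i) with end.

Definition reduct (M : structure LX) : structure L :=
  @Structure L M (carrier_nonempty M) (fun f => @finterp LX M (inl f))
    (fun r => @rinterp LX M r).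

Definition constant (M : structure LX) (x : X) : M :=
  @finterp LX M (inr x) (@noargs M).

Fixpoint name_term (V W : Type) (s : V -> W + X) (t : term L V) : term LX W :=
  match t with
  | Var v => match s v with
             | inl w => Var LX w
             | inr x => @App LX W (inr x) (@noargs _)
             end
  | App f args => @App LX W (inl f) (fun i => name_term s (args i))
  end.

Fixpoint name (V : Type) (phi : form L V) : forall W : Type, (V -> W + X) -> form LX W :=
  match phi with
  | Bot => fun W s => Bot
  | Eq t u => fun W s => Eq (name_term s t) (name_term s u)
  | Rel r args => fun W s => @Rel LX W r (fun i => name_term s (args i))
  | Imp phi1 phi2 => fun W s => Imp (name phi1 s) (name phi2 s)
  | All phi1 => fun W s => All (name phi1 (fun o =>
      if o is Some v then match s v with inl w => inl (Some w) | inr x => inr x end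
      else inl None))
  end.

(** The map [s] may place the constants at any variables of [W]; for EM-formulas they become the
    appended coordinates of the tuple [x_0]. *)
Fixpoint unname_term (V W : Type) (s : V + X -> W) (t : term LX V) : term L W :=
  match t with
  | Var v => Var L (s (inl v))
  | App f args =>
      match f return ('I_(@farity LX f) -> term L W) -> term L W with
      | inl g => fun args' => @App L W g args'
      | inr x => fun _ => Var L (s (inr x))
      end (fun i => unname_term s (args i))
  end.

Fixpoint unname (V : Type) (phi : form LX V) : forall W : Type, (V + X -> W) -> form L W :=
  match phi with
  | Bot => fun W s => Bot
  | Eq t u => fun W s => Eq (unname_term s t) (unname_term s u)
  | Rel r args => fun W s => @Rel L W r (fun i => unname_term s (args i))
  | Imp phi1 phi2 => fun W s => Imp (unname phi1 s) (unname phi2 s)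
  | All phi1 => fun W s => All (unname phi1 (fun o =>
      match o with
      | inl (Some v) => Some (s (inl v))
      | inl None => None
      | inr x => Some (s (inr x))
      end))
  end.

Variable M : structure LX.

Definition name_env (V W : Type) (s : V -> W + X) (e : W -> M) : V -> M :=
  fun v => match s v with inl w => e w | inr x => constant M x end.

Lemma eval_name (V W : Type) (s : V -> W + X) (e : W -> M) (t : term L V) :
  eval e (name_term s t) = @eval L (reduct M) V (name_env s e) t.
Proof.
elim: t => [v|f args IH] /=.
  rewrite /name_env; case: (s v) => //= x; congr (@finterp LX M (inr x)).
  by apply/funext => -[].
by congr (@finterp LX M (inl f)); apply/funext.
Qed.

Lemma sat_name (V W : Type) (s : V -> W + X) (e : W -> M) (phi : form L V) :
  sat (name phi s) e <-> @sat L (reduct M) V phi (name_env s e).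
Proof.
elim: phi W s e => {V} [V|V t u|V r args|V phi1 IH1 phi2 IH2|V phi IH] W s e //=.
- by rewrite !eval_name.
- have -> // : (fun i => eval e (name_term s (args i))) =
      (fun i => @eval L (reduct M) V (name_env s e) (args i)).
  by apply/funext => i; rewrite eval_name.
- by rewrite IH1 IH2.
- have E x : name_env (fun o => if o is Some v
          then match s v with inl w => inl (Some w) | inr x => inr x end else inl None)
        (fun o => if o is Some w then e w else x) =
      (fun o => if o is Some v then name_env s e v else x).
    by apply/funext => -[v|] //=; rewrite /name_env; case: (s v).
  by split=> sphi x; move: (sphi x); rewrite IH E.
Qed.

Lemma eval_unname (V W : Type) (s : V + X -> W) (e : W -> M) (t : term LX V) :
  (forall x, e (s (inr x)) = constant M x) ->
  @eval L (reduct M) W e (unname_term s t) = eval (e \o s \o inl) t.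
Proof.
move=> se; elim: t => [v|[f|x] args IH] //=.
  by congr (@finterp LX M (inl f)); apply/funext.
by rewrite se; congr (@finterp LX M (inr x)); apply/funext => -[].
Qed.

Lemma sat_unname (V W : Type) (s : V + X -> W) (e : W -> M) (phi : form LX V) :
  (forall x, e (s (inr x)) = constant M x) ->
  @sat L (reduct M) W (unname phi s) e <-> sat phi (e \o s \o inl).
Proof.
elim: phi W s e => {V} [V|V t u|V r args|V phi1 IH1 phi2 IH2|V phi IH] W s e se //=.
- by rewrite !eval_unname.
- have -> // : (fun i => @eval L (reduct M) W e (unname_term s (args i))) =
      (fun i => eval (e \o s \o inl) (args i)).
  by apply/funext => i; rewrite eval_unname.
- by rewrite IH1 // IH2.
- split=> sphi x; move: (sphi x); rewrite IH //;
  by rewrite (_ : _ \o _ = fun o => if o is Some v then (e \o s \o inl) v else x) //;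
    apply/funext => -[].
Qed.

End Constants.

Lemma reduct_expand (L : language) (U : structure L) (B : set U) (phi : sentence L) :
  holds (reduct (expand B)) phi <-> holds U phi.
Proof. by case: U B. Qed.

(** * Indiscernibility over parameters *)

Lemma EM_dichotomy_congr (L L' : language) (U : structure L) (U' : structure L')
    (J K K' : Type) (lt : J -> J -> Prop) (b : J -> K -> U) (b' : J -> K' -> U')
    (n : nat) (phi : EM_form L K n) (phi' : EM_form L' K' n) :
  (forall s : 'I_n -> J, sat phi (fun v => b (s v.1) v.2) <->
                         sat phi' (fun v => b' (s v.1) v.2)) ->
  EM_type lt b phi \/ EM_type lt b (Neg phi) ->
  EM_type lt b' phi' \/ EM_type lt b' (Neg phi').
Proof.
by move=> E [H|H]; [left|right] => s /H; [rewrite E|rewrite /= E].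
Qed.

(** With no tuple of variables there is only one valuation. This case stands apart because there is
    no [x_0] whose coordinates could replace the constants. *)
Lemma EM_dichotomy0 (L : language) (U : structure L) (J K : Type)
    (lt : J -> J -> Prop) (b : J -> K -> U) (phi : EM_form L K 0) :
  EM_type lt b phi \/ EM_type lt b (Neg phi).
Proof.
have E (e e' : 'I_0 * K -> U) : e = e' by apply/funext => -[[]].
pose e0 (v : 'I_0 * K) : U := noargs _ v.1.
case: (pselect (sat phi e0)) => sphi; [left|right] => s _.
  by have -> : (fun v => b (s v.1) v.2) = e0 by exact: E.
by have -> : (fun v => b (s v.1) v.2) = e0 by exact: E.
Qed.

Section Transfer.
Variables (L : language) (X : Type) (M : structure (lang_with L X)) (U : structure L).
Variables (P : Type) (p : P -> M) (q : P -> U) (c : X -> P).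
Hypothesis pq : forall (W : Type) (phi : form L W) (r : W -> P),
  @sat L (reduct M) W phi (p \o r) <-> sat phi (q \o r).
Hypothesis pc : forall x, p (c x) = constant M x.

(** The elements of [P] serve as names, read in [M] by [p] and in [U] by [q] with the same [L]-type,
    so that one sequence of names describes a sequence in each structure. *)
Definition append_params (K : Type) (b : K -> P) (k : K + X) : P :=
  match k with inl k => b k | inr x => c x end.

(** From left to right, the appended variables of every tuple are replaced by the constants. From
    right to left, the constants are read off the first tuple, which exists when [n > 0]. The
    relation [lt] is arbitrary, so that orders with inserted points are covered. *)
Lemma indiscernible_params (J K : Type) (lt : J -> J -> Prop) (b : J -> K -> P) :
  indiscernible lt (fun j => p \o b j) <->
  indiscernible lt (fun j => q \o append_params (b j)).
Proof.
split=> ind n phi.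
- pose s (v : 'I_n * (K + X)) : ('I_n * K) + X :=
    match v.2 with inl k => inl (v.1, k) | inr x => inr x end.
  apply: EM_dichotomy_congr (ind n (name phi s)) => f; rewrite sat_name.
  rewrite -(pq phi (fun v => append_params (b (f v.1)) v.2)).
  have -> // : name_env s (fun v => (p \o b (f v.1)) v.2) =
      p \o (fun v => append_params (b (f v.1)) v.2).
  by apply/funext => -[i [k|x]] //=; rewrite pc.
- case: n phi => [|n] phi; first exact: EM_dichotomy0.
  pose s (v : ('I_n.+1 * K) + X) : 'I_n.+1 * (K + X) :=
    match v with inl v => (v.1, inl v.2) | inr x => (ord0, inr x) end.
  apply: EM_dichotomy_congr (ind n.+1 (unname phi s)) => f.
  rewrite -(pq _ (fun v => append_params (b (f v.1)) v.2)).
  by rewrite sat_unname // => x /=; rewrite pc.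
Qed.

End Transfer.

(** The part below the first cut has no maximum, so iterated choice climbs in it forever. This
    supplies the infinite index set demanded by [complete_EM_type]. *)
Lemma dedekind_infinite d (I : orderType d) n (P : 'I_n.+2 -> set I) :
  dedekind_partition P -> infinite_set [set: I].
Proof.
move=> [[/(_ ord0)[x0 Px0] _ _ _] /(_ ord0) [nomax _]].
apply/infiniteP/embeds_card.
have /choice[next nextP] x : exists y, lower P ord0 x -> lower P ord0 y /\ (x < y)%O.
  case: (pselect (lower P ord0 x)) => lx; last by exists x.
  apply: contrapT => ny; apply: nomax; exists x; split=> // y ly.
  by rewrite leNgt; apply/negP => xy; apply: ny; exists y.
pose f k := iter k next x0.
have fl k : lower P ord0 (f k).
  by elim: k => [|k /nextP[]//]; exists ord0.
have fS k : (f k < f k.+1)%O by have [] := nextP _ (fl k).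
have fmono k l : k < l -> (f k < f l)%O.
  elim: l => // l IH; rewrite ltnS leq_eqVlt => /orP[/eqP -> //|/IH fkl].
  exact: lt_trans fkl (fS l).
exists f => k l fkl.
by case: (ltngtP k l) => // /fmono; rewrite fkl ltxx.
Qed.

(** * Distality over parameters *)

Lemma distal_theory_over (L : language) (kappa : Type) (T : theory L)
    (U : structure L) (B : set U) (m : nat) :
  complete_theory T -> monster kappa T U -> small kappa B ->
  distal_theory kappa m T -> distal_theory kappa m (theory_over B).
Proof.
move=> complT monU sB distT T' V [_ subT'] [_ modV _ _] K sK Gamma _.
move=> d I b P sI indb _ dedP A ninsA.
have [[sN sF sR] modU univU _] := monU.
(* A sentence of [T], read in the larger language, is true in [expand B], hence lies in
   [theory_over B] and in [T'], and so holds in [V]. *)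
have modR : model T (reduct V).
  move=> phi Tphi.
  have void_env (S : Type) (e e' : void -> S) : e = e' by apply/funext => -[].
  have : holds V (name phi (of_void (void + set_type B))).
    apply/modV/subT'/sat_name.
    rewrite (void_env _ (name_env _ _) (of_void _)).
    exact/reduct_expand/modU.
  by rewrite /holds => /sat_name; rewrite (void_env _ (name_env _ _) (of_void _)).
(* Names for all entries of the sequence, of the candidates and for the constants. They are moved to
   [U] as one tuple, so that their joint type is kept. *)
pose Q := (((I * K) + ('I_m.+1 * K)) + set_type B)%type.
have sB' := small_set_type sB.
have sO : small kappa [set: 'I_m.+1].
  by apply: small_embeds sN; exists (@nat_of_ord _); exact: ord_inj.
have sQ : small kappa [set: Q].
  by apply: small_sum => //; apply: small_sum => //; exact: small_prod.
pose p (z : Q) : V := match z with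
  | inl (inl v) => b v.1 v.2
  | inl (inr v) => A v.1 v.2
  | inr x => constant V x
  end.
have [q pq] := realize_small_tuple (M := reduct V) p
  (And3 sN sF sR) univU modR sQ.
pose c (x : set_type B) : Q := inr x.
pose bQ i k : Q := inl (inl (i, k)).
pose AQ i k : Q := inl (inr (i, k)).
pose ext (f : K -> Q) := q \o append_params c f.
have indE := @indiscernible_params _ _ V U Q p q c pq (fun=> erefl).
have insE (D : {set 'I_m.+1}) : inserts P b A D <->
    inserts P (fun i => ext (bQ i)) (fun i => ext (AQ i)) D.
  pose w (x : I + {i | i \in D}) := match x with inl u => bQ u | inr i => AQ (sval i) end.
  have := indE _ _ (insert_lt P (D := D)) w; rewrite /inserts.
  have -> : (fun j => p \o w j) = insert_seq b A (D := D) by apply/funext => -[].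
  have -> // : (fun j => q \o append_params c (w j)) =
    insert_seq (fun i => ext (bQ i)) (fun i => ext (AQ i)) (D := D).
  by apply/funext => -[].
have indb' : indiscernible (@ord_lt d I) (fun i => ext (bQ i)).
  by apply/indE; exact: indb.
have sKB := small_sum sN sK sB'.
have cEM : complete_EM_type kappa U
    (EM_type (@ord_lt d I) (fun i => ext (bQ i))).
  exists d, I, (fun i => ext (bQ i)); split=> //.
  exact: dedekind_infinite dedP.
(* The complete theory [T] is its own completion. Index order and partition are unchanged; only the
   tuples have grown. *)
have [|D [Dm nD]] := distT T U (conj complT (@subset_refl _ T)) monU _ sKB _ cEM d I
    (fun i => ext (bQ i)) P sI indb' erefl dedP (fun i => ext (AQ i)).
  by move/insE.
by exists D; split=> // /insE.
Qed.

Theorem proposition3p15 (L : language) (kappa : Type) (T : theory L)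
    (U : structure L) (B : set U)
    (T_complete : complete_theory T) (T_infinite : has_infinite_models T)
    (U_monster : monster kappa T U) (B_small : small kappa B) :
  rank_le (DR kappa (theory_over B)) (DR kappa T).
Proof.
rewrite /DR; case: (pselect (exists m, (0 < m)%N && `[< distal_theory kappa m T >])).
  move=> exT; case: (ex_minnP exT) => m /andP[m0 /asboolP distT] _.
  (* The rank [m] of [T] is among the candidates for [theory_over B], so the least candidate is at
     most [m]. *)
  have PB : (0 < m)%N && `[< distal_theory kappa m (theory_over B) >].
    by rewrite m0; apply/asboolP; exact: distal_theory_over distT.
  case: pselect => [exB|[]]; last by exists m.
  by case: ex_minnP => n _; exact.
by move=> _; case: pselect.
Qed.
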